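(* Let $n\in\mathbb{N}$, let $E$ be an Archimedean vector lattice, let $h\colon\mathbb{R}^n\to\mathbb{R}$ be a continuous positively homogeneous function, and let $f_1,\dots,f_n\in E$. Then $(c)\sim h(f_1,\dots,f_n)$ is defined in $E$ if and only if $(s)\sim h(f_1,\dots,f_n)$ is defined in $E$, and in this case $$(c)\sim h(f_1,\dots,f_n)=(s)\sim h(f_1,\dots,f_n).$$
   Context: A function $h\colon\mathbb{R}^n\to\mathbb{R}$ is positively homogeneous if $h(\lambda\bar{x})=\lambda h(\bar{x})$ for all $\lambda\in[0,\infty)$ and $\bar{x}\in\mathbb{R}^n$. A map is sublinear if it is positively homogeneous and subadditive, and superlinear if its negative is sublinear. Continuous calculus: for $g\in E$, let $\langle f_1,\dots,f_n,g\rangle$ be the vector sublattice of $E$ generated by $f_1,\dots,f_n,g$, and let $H(\langle f_1,\dots,f_n,g\rangle)$ be the set of real-valued vector lattice homomorphisms on it. If there is $g\in E$ such that $h(\omega(f_1),\dots,\omega(f_n))=\omega(g)$ for every $\omega\in H(\langle f_1,\dots,f_n,g\rangle)$, then $(c)\sim h(f_1,\dots,f_n)$ is defined in $E$ and equals $g$. Semicontinuous calculus: for $\phi\colon\mathbb{R}^n\to\mathbb{R}$ sublinear, $\underline{\partial}\phi(\bar{0}):=\{\bar{a}\in\mathbb{R}^n: \sum_{i=1}^n a_ix_i\le\phi(\bar{x})\ \forall\bar{x}\in\mathbb{R}^n\}$, and $\phi(f_1,\dots,f_n)$ is defined in $E$ if $\sup_{\bar{a}\in\underline{\partial}\phi(\bar{0})}\sum_{i=1}^n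 a_if_i$ exists in $E$, in which case it denotes this supremum. For $\psi$ superlinear, $\overline{\partial}\psi(\bar{0}):=\{\bar{a}\in\mathbb{R}^n: \sum_{i=1}^n a_ix_i\ge\psi(\bar{x})\ \forall\bar{x}\in\mathbb{R}^n\}$, and $\psi(f_1,\dots,f_n)$ is defined in $E$ if $\inf_{\bar{a}\in\overline{\partial}\psi(\bar{0})}\sum_{i=1}^n a_if_i$ exists in $E$, in which case it denotes this infimum. Let $h$ be positively homogeneous and bounded on the unit sphere $\{\|\bar{x}\|=1\}$. If $h$ is upper semicontinuous, $(s)\sim h(f_1,\dots,f_n)$ is defined in $E$ when there is a family $\Phi$ of sublinear maps with $h(\bar{x})=\inf_{\phi\in\Phi}\phi(\bar{x})$ for all $\bar{x}\in\mathbb{R}^n$ such that every $\phi(f_1,\dots,f_n)$, $\phi\in\Phi$, is defined in $E$ and $\inf_{\phi\in\Phi}\phi(f_1,\dots,f_n)$ exists in $E$; its value is this infimum. If $h$ is lower semicontinuous, $(s)\sim h(f_1,\dots,f_n)$ is defined in $E$ when there is a family $\Psi$ of superlinear maps with $h(\bar{x})=\sup_{\psi\in\Psi}\psi(\bar{x})$ for all $\bar{x}\in\mathbb{R}^n$ such that every $\psi(f_1,\dots,f_n)$, $\psi\in\Psi$, is defined in $E$ and $\sup_{\psi\in\Psi}\psi(f_1,\dots,f_n)$ exists in $E$; its value is this supremum. For continuous $h$ (which is automatically bounded on the unit sphere) either clause may be used. The value does not depend on the representation chosen. *)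

(* Defs.v *)
From HB Require Import structures.
From mathcomp Require Import all_boot all_order all_algebra.
From mathcomp Require Import all_classical all_reals all_analysis.

Set Implicit Arguments.
Unset Strict Implicit.
Unset Printing Implicit Defensive.

Import Order.TTheory GRing.Theory Num.Theory.
Import numFieldNormedType.Exports.

Local Open Scope classical_set_scope.
Local Open Scope ring_scope.

(* The lattice operations belong to the mixin, with the laws leUx and lexI of
   Order.Lattice: HB cannot join Order.Lattice with GRing.Zmodule, because
   RealDomain inherits from both without such a join. *)
HB.mixin Record isVectorLattice (R : numDomainType) E
    of GRing.Lmodule R E & Order.POrder ring_display E := {
  vjoin : E -> E -> E ;
  vmeet : E -> E -> E ;
  vleUx : forall x y z : E, (vjoin x y <= z) = (x <= z) && (y <= z) ;
  vlexI : forall x y z : E, (x <= vmeet y z) = (x <= y) && (x <= z) ;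
  vlerD2r : forall z x y : E, x <= y -> x + z <= y + z ;
  vlerZ2l : forall (a : R) (x y : E), 0 <= a -> x <= y -> a *: x <= a *: y
}.

#[short(type="vectorLatticeType")]
HB.structure Definition VectorLattice (R : numDomainType) :=
  { E of GRing.Lmodule R E & Order.POrder ring_display E & isVectorLattice R E }.

Definition archimedean_vlat (R : numDomainType) (E : vectorLatticeType R) :=
  forall x y : E, 0 <= x -> (forall k : nat, x *+ k <= y) -> x = 0.

Section VectorLatticeNotions.
Context {R : numDomainType} {E : vectorLatticeType R}.

Definition vector_sublattice (L : set E) : Prop :=
  [/\ L 0,
      forall x y, L x -> L y -> L (x + y),
      forall (a : R) x, L x -> L (a *: x)
    & forall x y, L x -> L y -> L (vjoin x y) /\ L (vmeet x y)].

Definition gen_vector_sublattice (A : set E) : set E :=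
  smallest vector_sublattice A.

End VectorLatticeNotions.

(* A homomorphism on the sublattice L is encoded by a total function on E of
   which only the restriction to L matters: every map L -> R extends to E. *)
Definition vlat_hom_on (R : realType) (E : vectorLatticeType R) (L : set E)
    (w : E -> R) : Prop :=
  [/\ forall x y, L x -> L y -> w (x + y) = w x + w y,
      forall (a : R) x, L x -> w (a *: x) = a * w x,
      forall x y, L x -> L y -> w (vjoin x y) = Num.max (w x) (w y)
    & forall x y, L x -> L y -> w (vmeet x y) = Num.min (w x) (w y)].

Section HomogeneousFunctions.
Context {R : realType} {n : nat}.
Implicit Types h phi psi : 'rV[R]_n -> R.

Definition pos_homogeneous h : Prop :=
  forall (l : R) (x : 'rV[R]_n), 0 <= l -> h (l *: x) = l * h x.

Definition sublinear phi : Prop :=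
  pos_homogeneous phi /\ forall x y, phi (x + y) <= phi x + phi y.

Definition superlinear psi : Prop := sublinear (fun x => - psi x).

Definition dotprod (a x : 'rV[R]_n) : R := \sum_(i < n) a 0 i * x 0 i.

(* Euclidean sphere: the library's norm on row vectors is the max norm. *)
Definition unit_sphere : set 'rV[R]_n :=
  [set x | Num.sqrt (\sum_(i < n) x 0 i ^+ 2) = 1].

Definition bounded_on_sphere h : Prop :=
  exists M : R, forall x, unit_sphere x -> `|h x| <= M.

Definition lsc h : Prop := lower_semicontinuous (fun x => (h x)%:E).
Definition usc h : Prop := lsc (fun x => - h x).

Definition subdiff0 phi : set 'rV[R]_n :=
  [set a | forall x, dotprod a x <= phi x].

Definition superdiff0 psi : set 'rV[R]_n :=
  [set a | forall x, psi x <= dotprod a x].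

End HomogeneousFunctions.

Section Calculi.
Context {R : realType} {E : vectorLatticeType R} {n : nat}.
Implicit Types (h phi psi : 'rV[R]_n -> R) (f : 'I_n -> E) (g v : E).

(* Each calculus is given by the relation "h(f_1, ..., f_n) is defined in E
   and equals g". *)

Definition c_calculus h f g : Prop :=
  forall w : E -> R,
    vlat_hom_on (gen_vector_sublattice (range f `|` [set g])) w ->
    h (\row_(i < n) w (f i)) = w g.

Definition lincomb f (a : 'rV[R]_n) : E := \sum_(i < n) a 0 i *: f i.

Definition sublinear_value phi f v : Prop :=
  supremums [set lincomb f a | a in subdiff0 phi] v.

Definition superlinear_value psi f v : Prop :=
  infimums [set lincomb f a | a in superdiff0 psi] v.

Definition s_calculus_usc h f g : Prop :=
  exists Phi : set ('rV[R]_n -> R),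
    [/\ Phi `<=` sublinear,
        forall x, infimums [set phi x | phi in Phi] (h x),
        forall phi, Phi phi -> exists v, sublinear_value phi f v
      & infimums [set v | exists2 phi, Phi phi & sublinear_value phi f v] g].

Definition s_calculus_lsc h f g : Prop :=
  exists Psi : set ('rV[R]_n -> R),
    [/\ Psi `<=` superlinear,
        forall x, supremums [set psi x | psi in Psi] (h x),
        forall psi, Psi psi -> exists v, superlinear_value psi f v
      & supremums [set v | exists2 psi, Psi psi & superlinear_value psi f v] g].

Definition s_calculus h f g : Prop :=
  [/\ pos_homogeneous h, bounded_on_sphere h
    & (usc h /\ s_calculus_usc h f g) \/ (lsc h /\ s_calculus_lsc h f g)].

End Calculi.

(* Main.v *)
Require Import Defs.
From mathcomp Require Import all_boot all_order all_algebra.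
From mathcomp Require Import all_classical all_reals all_analysis.
From mathcomp Require Import lra.
Import Order.TTheory GRing.Theory Num.Theory.
Import numFieldNormedType.Exports.
Local Open Scope classical_set_scope.
Local Open Scope ring_scope.

Set Implicit Arguments.
Unset Strict Implicit.
Unset Printing Implicit Defensive.

(** The proof reduces inequalities in [E] to inequalities between real numbers.
    In an Archimedean vector lattice, two elements of a finitely generated
    sublattice that are not in order are told apart by a real-valued lattice
    homomorphism ([vlat_hom_separation]). Such a homomorphism is obtained from a
    prime ideal by taking standard parts in the totally ordered quotient, with
    an order unit as the unit of measure.

    The two calculi meet at polyhedral functions, the maxima and sums of linear
    forms. Their values in [E] are given by finite lattice expressions, on which
    homomorphisms can be evaluated and which are also the suprema that define
    the semicontinuous calculus ([max_linear_value]). A continuous positively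
    homogeneous [h] has, for each point and each [eps > 0], a polyhedral
    majorant that exceeds [h] by at most [eps] at that point
    ([continuous_majorant]); a sublinear function has one that touches it at the
    point ([sublinear_majorant]).

    If [g] is the value of [h] in the continuous calculus, the family of all
    polyhedral majorants of [h] represents [h], and [g] is the infimum of their
    values because the corresponding inequality holds under every homomorphism.
    The family is not directed, but each homomorphism tests a single point, so
    that pointwise approximation of [h] suffices.

    Conversely, let [g] be the infimum of the values of a family of sublinear
    functions with infimum [h], and let [w] be a homomorphism on the sublattice
    generated by the [f_i] and [g]. A polyhedral majorant of a member [phi] of
    the family dominates the value of [phi], hence [g]; this gives
    [w g <= h (w f_1, ..., w f_n)]. A polyhedral minorant of [h] has a value below
    that of every [phi], by separation and by the Hahn-Banach theorem
    ([subdiff0_attained]), hence below [g]; this gives the other inequality.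
    Suprema of superlinear functions are covered by replacing [h] and [g] with
    their opposites. Finally the value in the continuous calculus is unique, by
    separation. *)

(** * Ordered-vector-space and lattice identities *)

Section VectorLatticeTheory.
Context {R : realType} {E : vectorLatticeType R}.
Implicit Types (x y z t c p e : E) (a b r : R) (S T : set E).

Lemma vlerD2 x y z t : x <= y -> z <= t -> x + z <= y + t.
Proof.
move=> xy zt; apply: (le_trans (vlerD2r z _ _ xy)).
by rewrite ![y + _]addrC vlerD2r.
Qed.

Lemma vlerD2rE z x y : (x + z <= y + z) = (x <= y).
Proof.
apply/idP/idP => [|/vlerD2r//].
by move=> /(vlerD2r (- z) _ _); rewrite !addrK.
Qed.

Lemma vsubr_ge0 x y : (0 <= y - x) = (x <= y).
Proof. by rewrite -[LHS](vlerD2rE x) add0r subrK. Qed.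

Lemma vlerBlDr x y z : (x - z <= y) = (x <= y + z).
Proof. by rewrite -[LHS](vlerD2rE z) subrK. Qed.

Lemma vlerBrDr x y z : (x <= y - z) = (x + z <= y).
Proof. by rewrite -[LHS](vlerD2rE z) subrK. Qed.

Lemma vlerN2 x y : (- x <= - y) = (y <= x).
Proof. by rewrite -[LHS](vlerD2rE (x + y)) addKr addrCA addNr addr0. Qed.

Lemma vlerZ2lE a x y : 0 < a -> (a *: x <= a *: y) = (x <= y).
Proof.
move=> a0; apply/idP/idP => [|/(vlerZ2l _ _ _ (ltW a0))//].
have ai : 0 <= a^-1 by rewrite invr_ge0 ltW.
by move=> /(vlerZ2l _ _ _ ai); rewrite !scalerA mulVf ?gt_eqF// !scale1r.
Qed.

Lemma vscaler_ge0 a x : 0 <= a -> 0 <= x -> 0 <= a *: x.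
Proof. by move=> a0 /(vlerZ2l _ _ _ a0); rewrite scaler0. Qed.

Lemma vlerZ2r a b x : 0 <= x -> a <= b -> a *: x <= b *: x.
Proof.
by move=> x0 ab; rewrite -vsubr_ge0 -scalerBl vscaler_ge0// subr_ge0.
Qed.

Lemma vjoin_ubl x y : x <= vjoin x y.
Proof. by have := lexx (vjoin x y); rewrite vleUx => /andP[]. Qed.

Lemma vjoin_ubr x y : y <= vjoin x y.
Proof. by have := lexx (vjoin x y); rewrite vleUx => /andP[]. Qed.

Lemma vmeet_lbl x y : vmeet x y <= x.
Proof. by have := lexx (vmeet x y); rewrite vlexI => /andP[]. Qed.

Lemma vmeet_lbr x y : vmeet x y <= y.
Proof. by have := lexx (vmeet x y); rewrite vlexI => /andP[]. Qed.

Lemma vjoin_lub x y z : x <= z -> y <= z -> vjoin x y <= z.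
Proof. by rewrite vleUx => -> ->. Qed.

Lemma vmeet_glb x y z : z <= x -> z <= y -> z <= vmeet x y.
Proof. by rewrite vlexI => -> ->. Qed.

Lemma vjoin_idPl x y : y <= x -> vjoin x y = x.
Proof. by move=> yx; apply/le_anti; rewrite vjoin_ubl vjoin_lub. Qed.

Lemma vmeet_oppE x y : vmeet x y = - vjoin (- x) (- y).
Proof.
apply/le_anti/andP; split.
  by rewrite -vlerN2 opprK vjoin_lub// vlerN2 ?vmeet_lbl ?vmeet_lbr.
by rewrite vmeet_glb// -vlerN2 opprK ?vjoin_ubl ?vjoin_ubr.
Qed.

Lemma vjoinZ a x y : 0 < a -> a *: vjoin x y = vjoin (a *: x) (a *: y).
Proof.
move=> a0; apply/le_anti/andP; split; last first.
  by rewrite vjoin_lub// vlerZ2lE// ?vjoin_ubl ?vjoin_ubr.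
have ai : 0 < a^-1 by rewrite invr_gt0.
rewrite -(vlerZ2lE _ _ ai) scalerA mulVf ?gt_eqF// scale1r vjoin_lub//.
  by rewrite -(vlerZ2lE _ _ a0) scalerA mulfV ?gt_eqF// scale1r vjoin_ubl.
by rewrite -(vlerZ2lE _ _ a0) scalerA mulfV ?gt_eqF// scale1r vjoin_ubr.
Qed.

Definition vpos x := vjoin x 0.

Lemma vpos_ge0 x : 0 <= vpos x. Proof. exact: vjoin_ubr. Qed.
Lemma vle_pos x : x <= vpos x. Proof. exact: vjoin_ubl. Qed.

Lemma vpos_lub x y : x <= y -> 0 <= y -> vpos x <= y.
Proof. exact: vjoin_lub. Qed.

Lemma vpos_mono x y : x <= y -> vpos x <= vpos y.
Proof.
by move=> xy; rewrite vpos_lub ?vpos_ge0// (le_trans xy)// vle_pos.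
Qed.

Lemma vaddr_ge0 x y : 0 <= x -> 0 <= y -> 0 <= x + y.
Proof. by move=> x0 y0; rewrite -[0]addr0 vlerD2. Qed.

Definition disjoint_elts x y := forall z, z <= x -> z <= y -> z <= 0.

Lemma disjoint_pos_neg x : disjoint_elts (vpos x) (vpos (- x)).
Proof.
move=> z zx zNx.
have -> : (z <= 0) = (vpos x <= vpos x - z).
  by rewrite -[RHS]vsubr_ge0 addrAC subrr add0r -vlerN2 oppr0.
apply: vpos_lub; last by rewrite vsubr_ge0.
have : vpos (- x) <= vpos x - x.
  by apply: vpos_lub; [rewrite -[leLHS]add0r vlerD2rE vpos_ge0 | rewrite vsubr_ge0 vle_pos].
move/(le_trans zNx); rewrite -(vlerD2rE x) subrK => zx'.
by rewrite -(vlerD2rE z) subrK addrC.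
Qed.

(** * Prime ideals and real-valued homomorphisms *)

(** The positive part of an order ideal of [E]. The empty set is allowed, so that
    the union of an empty chain qualifies in the maximality argument. *)
Definition solid_cone S :=
  [/\ forall x, S x -> 0 <= x,
      forall x y, 0 <= y -> y <= x -> S x -> S y
    & forall x y, S x -> S y -> S (x + y)].

Lemma exists_maximal_solid_cone p : exists S,
  (solid_cone S /\ ~ S p) /\ forall B, S `<` B -> ~ (solid_cone B /\ ~ B p).
Proof.
apply: (@Zorn_bigcup E [set S | solid_cone S /\ ~ S p]) => F FP Ftot; split.
  split.
  - by move=> x [X FX Xx]; have [[+ _ _] _] := FP _ FX; apply.
  - move=> x y y0 yx [X FX Xx]; exists X => //.
    by have [[_ + _] _] := FP _ FX; apply; eauto.
  - move=> x y [X FX Xx] [Y FY Yy].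
    have [XY|YX] := Ftot _ _ FX FY.
      exists Y => //; have [[_ _ +] _] := FP _ FY; apply => //; exact: XY.
    exists X => //; have [[_ _ +] _] := FP _ FX; apply => //; exact: YX.
by move=> [X FX Xp]; have [_] := FP _ FX; apply.
Qed.

Definition solid_cone_adjoin S x : set E :=
  [set z | 0 <= z /\ exists s k, [/\ S s, 0 <= k & z <= s + k *: x]].

Lemma solid_cone_adjoinP S x : solid_cone S -> S 0 -> 0 <= x ->
  [/\ solid_cone (solid_cone_adjoin S x), S `<=` solid_cone_adjoin S x
    & solid_cone_adjoin S x x].
Proof.
move=> [S0 Ss SD] S00 x0; split.
- split; first by move=> ? [].
    move=> u v v0 vu [_ [s [k [Ss' k0 us]]]]; split=> //.
    by exists s, k; split=> //; exact: le_trans us.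
  move=> u v [u0 [s [k [Ss1 k0 us]]]] [v0 [t [l [St l0 vt]]]]; split.
    exact: vaddr_ge0.
  exists (s + t), (k + l); split; [exact: SD|exact: addr_ge0|].
  by rewrite scalerDl addrACA vlerD2.
- move=> z Sz; split; first exact: S0.
  by exists z, 0; split=> //; rewrite scale0r addr0.
- split=> //; exists 0, 1; split=> //.
  by rewrite add0r scale1r.
Qed.

(** An ideal maximal among those avoiding [p] is prime: if it contained neither
    of two disjoint elements [x] and [y], adjoining either one would put [p] below
    [s + k x] and below [t + l y] with [s] and [t] in the ideal, hence below
    [s + t] because [x] and [y] are disjoint; so [p] would be in the ideal. *)
Lemma exists_prime_solid_cone p : 0 <= p -> p <> 0 -> exists S,
  [/\ solid_cone S, S 0, ~ S p &
      forall x y, 0 <= x -> 0 <= y -> disjoint_elts x y -> S x \/ S y].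
Proof.
move=> p0 pn0; have [S [[cS Sp] maxS]] := exists_maximal_solid_cone p.
have S00 : S 0.
  apply: contrapT => nS0; apply: (maxS [set 0]).
    have nS x : S x -> False.
      by case: (cS) => S0 Ss _ Sx; apply: nS0; apply: (Ss x) => //; exact: S0.
    by split=> [x /nS//|/(_ 0 erefl)].
  split=> //; split=> [x ->//|x y y0 + x0|x y -> ->]; last by rewrite /= addr0.
  by rewrite x0 => yle0; apply/le_anti; rewrite yle0 y0.
exists S; split=> // x y x0 y0 xy.
apply: contrapT => /not_orP[nSx nSy].
have adj z : 0 <= z -> ~ S z -> solid_cone_adjoin S z p.
  move=> z0 nSz; have [cA SA Az] := solid_cone_adjoinP cS S00 z0.
  apply: contrapT => nAp; apply: (maxS (solid_cone_adjoin S z)) => //.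
  by split=> // /(_ _ Az).
have [_ [s [k [Ss k0 ps]]]] := adj _ x0 nSx.
have [_ [t [l [St l0 pt]]]] := adj _ y0 nSy.
case: (cS) => S0 Ssol SD.
apply: Sp; apply: (Ssol (s + t)) => //; last exact: SD.
(* A common positive bound of the multipliers of [x] and [y]: dividing by it
   brings [p - (s + t)] below both. *)
pose m := 1 + (k + l).
have m0 : 0 < m by rewrite ltr_pwDl// addr_ge0.
have mi0 : 0 < m^-1 by rewrite invr_gt0.
have dis z j : 0 <= j <= m -> p <= s + t + j *: z -> 0 <= z -> m^-1 *: (p - (s + t)) <= z.
  move=> /andP[j0 jm] pz z0.
  rewrite -(vlerZ2lE _ _ m0) scalerA mulfV ?gt_eqF// scale1r vlerBlDr addrC.
  by rewrite (le_trans pz)// addrC [leRHS]addrC vlerD2// vlerZ2r.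
rewrite -[s + t]add0r -vlerBlDr -(vlerZ2lE _ _ mi0) scaler0; apply: xy.
  apply: (dis _ k) => //; first by apply/andP; split=> //; rewrite /m; lra.
  by rewrite (le_trans ps)// addrAC -[leLHS]addr0 vlerD2// S0.
apply: (dis _ l) => //; first by apply/andP; split=> //; rewrite /m; lra.
by rewrite (le_trans pt)// -addrA -[leLHS]add0r vlerD2// S0.
Qed.

(** The set of elements that are at most 0 modulo a prime ideal: the last clause
    says that the quotient is totally ordered. *)
Definition prime_cone T :=
  [/\ forall x y, T x -> T y -> T (x + y),
      forall x y, y <= x -> T x -> T y,
      forall x y, T x -> T y -> T (vjoin x y)
    & forall x, T x \/ T (- x)].

(** The prime ideal is one avoiding the positive part of [c]. Positive and
    negative parts being disjoint, primality makes the quotient total. *)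
Lemma exists_prime_cone c : ~~ (c <= 0) -> exists2 T, prime_cone T & ~ T c.
Proof.
move=> c0.
have pn0 : vpos c <> 0 by move=> pc; rewrite -pc vle_pos in c0.
have [S [[S0 Ss SD] S00 nSp prS]] := exists_prime_solid_cone (vpos_ge0 c) pn0.
exists (fun x => S (vpos x)) => //; split.
- move=> x y Sx Sy; apply: Ss (SD _ _ Sx Sy); first exact: vpos_ge0.
  by rewrite vpos_lub ?vlerD2 ?vle_pos// vaddr_ge0 ?vpos_ge0.
- move=> x y xy; apply: Ss; [exact: vpos_ge0|exact: vpos_mono].
- move=> x y Sx Sy; apply: Ss (SD _ _ Sx Sy); first exact: vpos_ge0.
  rewrite vpos_lub// ?vaddr_ge0 ?vpos_ge0// vjoin_lub//.
    by rewrite -[leLHS]addr0 vlerD2 ?vle_pos ?vpos_ge0.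
  by rewrite -[leLHS]add0r vlerD2 ?vle_pos ?vpos_ge0.
- by move=> x; apply: prS; [exact: vpos_ge0|exact: vpos_ge0|exact: disjoint_pos_neg].
Qed.

Definition principal_ideal e : set E :=
  [set y | exists2 C : R, - (C *: e) <= y & y <= C *: e].

Lemma principal_ideal_sublattice e : 0 <= e ->
  vector_sublattice (principal_ideal e).
Proof.
move=> e0.
have widen x C D : C <= D -> - (C *: e) <= x -> x <= C *: e ->
    - (D *: e) <= x /\ x <= D *: e.
  move=> CD xC Cx; split; last by rewrite (le_trans Cx)// vlerZ2r.
  by rewrite (le_trans _ xC)// vlerN2 vlerZ2r.
split.
- by exists 0; rewrite scale0r ?oppr0.
- move=> x y [C Cx xC] [D Dy yD]; exists (C + D).
    by rewrite scalerDl opprD vlerD2.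
  by rewrite scalerDl vlerD2.
- move=> a x [C Cx xC]; exists (`|a| * C).
    have [a0|a0] := ger0P a.
      by rewrite -scalerA -scalerN vlerZ2l.
    by rewrite -scalerA -vlerN2 opprK -scaleNr vlerZ2l// ?oppr_ge0 ltW.
  have [a0|a0] := ger0P a.
    by rewrite -scalerA vlerZ2l.
  rewrite -scalerA scaleNr -scalerN -vlerN2 -[- (a *: x)]scaleNr -[- (a *: - _)]scaleNr.
  by rewrite vlerZ2l// oppr_ge0 ltW.
- move=> x y [C Cx xC] [D Dy yD].
  have [] := widen x C (Num.max C D) _ Cx xC; first by rewrite le_max lexx.
  have [] := widen y D (Num.max C D) _ Dy yD; first by rewrite le_max lexx orbT.
  move=> My yM Mx xM; split; exists (Num.max C D).
  + by rewrite (le_trans Mx)// vjoin_ubl.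
  + exact: vjoin_lub.
  + exact: vmeet_glb.
  + by rewrite (le_trans _ xM)// vmeet_lbl.
Qed.

Lemma principal_ideal_le e x : 0 <= x -> x <= e -> principal_ideal e x.
Proof.
move=> x0 xe; exists 1; rewrite scale1r//.
by rewrite (le_trans _ x0)// -oppr0 vlerN2 (le_trans x0).
Qed.

Section PrimeConeTheory.
Variables (T : set E) (e : E).
Hypotheses (prT : prime_cone T) (e0 : 0 <= e) (nTe : ~ T e).
Let TD x y : T x -> T y -> T (x + y). Proof. by case: prT => + _ _ _; apply. Qed.
Let Tle x y : y <= x -> T x -> T y. Proof. by case: prT => _ + _ _; apply. Qed.
Let TU x y : T x -> T y -> T (vjoin x y). Proof. by case: prT => _ _ + _; apply. Qed.
Let Tor x : T x \/ T (- x). Proof. by case: prT => _ _ _; apply. Qed.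

Lemma prime_cone0 : T 0.
Proof. by case: (Tor 0); rewrite ?oppr0. Qed.

Lemma prime_coneZ a x : 0 <= a -> T x -> T (a *: x).
Proof.
move=> a0 Tx.
have Tk k : T (vpos x *+ k).
  elim: k => [|k IH]; first by rewrite mulr0n; exact: prime_cone0.
  by rewrite mulrS; apply: TD => //; apply: TU => //; exact: prime_cone0.
apply: (Tle _ (Tk (Num.bound a))).
apply: (@le_trans _ _ (a *: vpos x)); first by rewrite vlerZ2l ?vle_pos.
by rewrite -scaler_nat vlerZ2r ?vpos_ge0// ltW// archi_boundP.
Qed.

(** The quotient by a prime ideal is a totally ordered vector space, in general
    not Archimedean. As [e] does not vanish there, each element of the ideal
    generated by [e] lies infinitely near, on the scale of [e], exactly one real
    multiple of [e], and the multiplier is its value. *)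
Definition standard_part y : R := sup [set r | T (r *: e - y)].
Local Notation w := standard_part.
Local Notation I := (principal_ideal e).

Let Tscale r : T (r *: e) -> r <= 0.
Proof.
move=> Tr; rewrite leNgt; apply/negP => r0; apply: nTe.
have ri : 0 <= r^-1 by rewrite invr_ge0 ltW.
by have := prime_coneZ ri Tr; rewrite scalerA mulVf ?gt_eqF// scale1r.
Qed.

Let has_sup_w y : I y -> has_sup [set r | T (r *: e - y)].
Proof.
move=> [C Cy yC]; split.
  exists (- C) => /=; apply: Tle (prime_cone0).
  by rewrite vlerBlDr add0r scaleNr.
exists C => r /= Tr; rewrite -subr_le0; apply: Tscale.
by apply: Tle Tr; rewrite scalerBl vlerD2// vlerN2.
Qed.

Lemma standard_part_lt y r : I y -> r < w y -> T (r *: e - y).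
Proof.
move=> Iy /(sup_gt (has_sup_w Iy).1) [s Ts rs].
by apply: Tle Ts; rewrite vlerD2rE vlerZ2r// ltW.
Qed.

Lemma standard_part_gt y r : I y -> w y < r -> T (y - r *: e).
Proof.
move=> Iy wr; case: (Tor (y - r *: e)) => //; rewrite opprB => Tr.
by have := ub_le_sup (has_sup_w Iy).2 Tr; rewrite leNgt wr.
Qed.

(** Two distinct reals cannot both satisfy these conditions: a gap between them
    would make a positive multiple of [e] nonpositive in the quotient. *)
Lemma standard_part_eq y s : I y ->
  (forall r, r < s -> T (r *: e - y)) -> (forall r, s < r -> T (y - r *: e)) ->
  w y = s.
Proof.
move=> Iy lo hi; apply/eqP; rewrite eq_le !leNgt; apply/andP; split; apply/negP.
  move=> sw; pose r1 := s + (w y - s) / 3; pose r2 := s + (w y - s) / 3 * 2.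
  have : T (r2 *: e - y) by apply: standard_part_lt => //; rewrite /r2; lra.
  have : T (y - r1 *: e) by apply: hi; rewrite /r1; lra.
  move=> /TD /[apply]; rewrite addrC subrKA -scalerBl => /Tscale.
  by rewrite /r1 /r2; lra.
move=> sw; pose r1 := w y + (s - w y) / 3; pose r2 := w y + (s - w y) / 3 * 2.
have : T (r2 *: e - y) by apply: lo; rewrite /r2; lra.
have : T (y - r1 *: e) by apply: standard_part_gt => //; rewrite /r1; lra.
move=> /TD /[apply]; rewrite addrC subrKA -scalerBl => /Tscale.
by rewrite /r1 /r2; lra.
Qed.

Lemma standard_part_unit : w e = 1.
Proof.
apply: standard_part_eq.
- exact: principal_ideal_le.
- move=> r r1; apply: Tle (prime_cone0).
  by rewrite vlerBlDr add0r -[leRHS]scale1r vlerZ2r// ltW.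
- move=> r r1; apply: Tle (prime_cone0).
  by rewrite vlerBlDr add0r -[leLHS]scale1r vlerZ2r// ltW.
Qed.

Lemma standard_part_le0 y : I y -> T y -> w y <= 0.
Proof.
move=> Iy Ty; rewrite leNgt; apply/negP => w0.
have /TD /(_ Ty) : T (w y / 2 *: e - y) by apply: standard_part_lt => //; lra.
by rewrite subrK => /Tscale; lra.
Qed.

(** Every operation is read off from Dedekind cuts through [standard_part_eq];
    the cut of a join is correct because [T] is closed under joins. *)
Lemma standard_part_hom : vlat_hom_on I w.
Proof.
have [I0 ID IZ IL] := principal_ideal_sublattice e0.
have wD x y : I x -> I y -> w (x + y) = w x + w y.
  move=> Ix Iy; apply: standard_part_eq; first exact: ID.
    move=> r rw; pose d := (w x + w y - r) / 2.
    have -> : r *: e - (x + y) = ((w x - d) *: e - x) + ((w y - d) *: e - y).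
      rewrite addrACA -scalerDl -opprD; congr (_ *: _ - _); rewrite /d; lra.
    by apply: TD; apply: standard_part_lt => //; rewrite /d; lra.
  move=> r rw; pose d := (r - w x - w y) / 2.
  have -> : (x + y) - r *: e = (x - (w x + d) *: e) + (y - (w y + d) *: e).
    rewrite [RHS]addrACA -opprD -scalerDl; congr (_ - _ *: _); rewrite /d; lra.
  by apply: TD; apply: standard_part_gt => //; rewrite /d; lra.
have w0 : w 0 = 0.
  by have := wD _ _ I0 I0; rewrite addr0 => /eqP; rewrite addrC -subr_eq subrr => /eqP.
have IN x : I x -> I (- x) by move=> /(IZ (- 1)); rewrite scaleN1r.
have wN x : I x -> w (- x) = - w x.
  by move=> Ix; apply/eqP; rewrite -addr_eq0 -wD ?addNr ?w0//; exact: IN.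
have wZpos a x : 0 < a -> I x -> w (a *: x) = a * w x.
  move=> a0 Ix; apply: standard_part_eq; first exact: IZ.
    move=> r rw; have -> : r *: e - a *: x = a *: ((r / a) *: e - x).
      by rewrite scalerBr scalerA mulrC divfK ?gt_eqF.
    apply: prime_coneZ; first exact: ltW.
    by apply: standard_part_lt => //; rewrite ltr_pdivrMr// mulrC.
  move=> r rw; have -> : a *: x - r *: e = a *: (x - (r / a) *: e).
    by rewrite scalerBr scalerA mulrC divfK ?gt_eqF.
  apply: prime_coneZ; first exact: ltW.
  by apply: standard_part_gt => //; rewrite ltr_pdivlMr// mulrC.
have wU x y : I x -> I y -> w (vjoin x y) = Num.max (w x) (w y).
  move=> Ix Iy; apply: standard_part_eq; first by have [] := IL _ _ Ix Iy.
    move=> r; rewrite lt_max => /orP[|] rw.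
      by apply: Tle (standard_part_lt Ix rw); rewrite vlerD2// vlerN2 vjoin_ubl.
    by apply: Tle (standard_part_lt Iy rw); rewrite vlerD2// vlerN2 vjoin_ubr.
  move=> r; rewrite gt_max => /andP[rx ry].
  apply: Tle (TU (standard_part_gt Ix rx) (standard_part_gt Iy ry)).
  by rewrite vlerBlDr vjoin_lub// -vlerBlDr ?vjoin_ubl ?vjoin_ubr.
split=> //.
- move=> a x Ix; case: (ltgtP a 0) => [a0|a0|->]; last by rewrite scale0r mul0r.
    rewrite -[a]opprK scaleNr wN; last exact: IZ.
    by rewrite wZpos ?oppr_gt0// !mulNr.
  exact: wZpos.
- move=> x y Ix Iy; rewrite vmeet_oppE wN; last first.
    by have [] := IL _ _ (IN _ Ix) (IN _ Iy).
  by rewrite wU ?wN ?oppr_max ?opprK//; exact: IN.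
Qed.

End PrimeConeTheory.

(** Were [d := x - y] not at most 0, the Archimedean property would give a [k]
    such that [k d] is not below [e]. Modulo a suitable prime ideal [e <= k d],
    so the standard part, which is 1 at [e], is at least [1 / k] at [d]. *)
Theorem principal_ideal_separation e x y : archimedean_vlat E -> 0 <= e ->
  principal_ideal e x -> principal_ideal e y ->
  (forall w : E -> R, vlat_hom_on (principal_ideal e) w -> w x <= w y) ->
  x <= y.
Proof.
move=> archE e0 Ix Iy sep.
have [I0 ID IZ IL] := principal_ideal_sublattice e0.
have Id : principal_ideal e (x - y).
  by apply: ID => //; have := IZ (- 1) _ Iy; rewrite scaleN1r.
set d := x - y in Id.
apply: contrapT => /negP; rewrite -vsubr_ge0 -opprB -oppr0 vlerN2 -/d => d0.
have [k kd] : exists k : nat, ~~ (d *+ k - e <= 0).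
  apply: contrapT => nk.
  have le_k k : d *+ k <= e.
    have : d *+ k - e <= 0 by apply: contrapT => /negP ?; apply: nk; exists k.
    by rewrite vlerBlDr add0r.
  suff p0 : vpos d = 0 by rewrite -p0 vle_pos in d0.
  apply: (archE _ e); first exact: vpos_ge0.
  case=> [|k]; first by rewrite mulr0n.
  rewrite -scaler_nat vjoinZ ?ltr0n// scaler0 vjoin_lub//.
  by rewrite scaler_nat.
have [T prT nT] := exists_prime_cone kd.
case: (prT) => TD Tle TU Tor.
have IkD : principal_ideal e (d *+ k) by rewrite -scaler_nat; exact: IZ.
have Te' : T (e - d *+ k) by case: (Tor (d *+ k - e)) => //; rewrite opprB.
have nTe : ~ T e.
  move=> Te; apply: nT; have [C _ dC] := IkD.
  have : T (Num.max C 0 *: e) by apply: (prime_coneZ prT) => //; rewrite le_max lexx orbT.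
  apply: Tle; rewrite vlerBlDr (le_trans dC)//.
  by rewrite -[leLHS]addr0 vlerD2// vlerZ2r// le_max lexx.
have hw := standard_part_hom prT e0 nTe.
have Ie : principal_ideal e e by exact: principal_ideal_le.
have Ixd : principal_ideal e (e - d *+ k).
  by apply: ID => //; have := IZ (- 1) _ IkD; rewrite scaleN1r.
have := standard_part_le0 prT e0 nTe Ixd Te'.
have := sep _ hw; case: hw => wD wZ _ _.
have INy : principal_ideal e (- y) by have := IZ (- 1) _ Iy; rewrite scaleN1r.
rewrite -scaler_nat -scaleNr wD//; last exact: IZ.
rewrite wZ// /d wD// -[- y]scaleN1r wZ// standard_part_unit//.
move=> wxy; rewrite leNgt => /negP; apply.
rewrite mulNr subr_gt0 (le_lt_trans _ ltr01)//.
by rewrite mulr_ge0_le0// ?ler0n// mulN1r subr_le0.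
Qed.

End VectorLatticeTheory.

(** * Bounds for homogeneous functions *)

Section HomogeneousTheory.
Context {R : realType} {n : nat}.
Implicit Types (h phi psi : 'rV[R]_n -> R) (a x y z e : 'rV[R]_n).

Lemma dotprodDl a b x : dotprod (a + b) x = dotprod a x + dotprod b x.
Proof.
by rewrite /dotprod -big_split/=; apply: eq_bigr => i _; rewrite mxE mulrDl.
Qed.

Lemma dotprodZl (k : R) a x : dotprod (k *: a) x = k * dotprod a x.
Proof.
by rewrite /dotprod mulr_sumr; apply: eq_bigr => i _; rewrite mxE mulrA.
Qed.

Lemma dotprodNl a x : dotprod (- a) x = - dotprod a x.
Proof. by rewrite -scaleN1r dotprodZl mulN1r. Qed.

Lemma dotprod_delta i x : dotprod (delta_mx 0 i) x = x 0 i.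
Proof.
rewrite /dotprod (bigD1 i)//= mxE !eqxx mul1r big1 ?addr0// => j ji.
by rewrite mxE eqxx/= (negbTE ji) mul0r.
Qed.

Definition l1norm x : R := \sum_i `|x 0 i|.

Lemma l1norm_ge0 x : 0 <= l1norm x.
Proof. exact: sumr_ge0. Qed.

Lemma l1normD x y : l1norm (x + y) <= l1norm x + l1norm y.
Proof.
by rewrite /l1norm -big_split ler_sum// => i _; rewrite mxE ler_normD.
Qed.

Lemma l1normZ (k : R) x : l1norm (k *: x) = `|k| * l1norm x.
Proof.
by rewrite /l1norm mulr_sumr; apply: eq_bigr => i _; rewrite mxE normrM.
Qed.

Lemma l1norm_eq0 x : l1norm x = 0 -> x = 0.
Proof.
move=> /eqP; rewrite psumr_eq0// => /allP x0; apply/rowP => i.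
by apply/eqP; rewrite mxE -normr_eq0; exact: (x0 i (mem_index_enum i)).
Qed.

Lemma mx_norm_le_l1norm x : `|x| <= l1norm x.
Proof.
rewrite [leLHS]mx_normrE; apply: bigmax_le => [|[i j] _]; first exact: l1norm_ge0.
by rewrite ord1 /l1norm (bigD1 j)//= lerDl sumr_ge0.
Qed.

Lemma pos_homogeneous0 h : pos_homogeneous h -> h 0 = 0.
Proof. by move=> hh; rewrite -(scale0r 0) hh// mul0r. Qed.

Lemma continuous_ball h x (eps : R) : continuous h -> 0 < eps ->
  exists2 d : R, 0 < d & forall y, `|x - y| < d -> `|h x - h y| < eps.
Proof.
move=> ch eps0.
have H : \forall y \near x, `|h x - h y| < eps.
  exact: (cvgr_dist_lt h (h x) (ch x) _ eps0).
by have /nbhs_normP[d /= d0 hd] := H; exists d.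
Qed.

Lemma continuous_l1_bound h : continuous h -> pos_homogeneous h ->
  exists2 M : R, 0 <= M & forall y, `|h y| <= M * l1norm y.
Proof.
move=> ch hh.
have [d d0 hd] := continuous_ball 0 ch ltr01.
exists (2 / d) => [|y]; first by rewrite divr_ge0// ltW.
have [/l1norm_eq0->|Ny] := eqVneq (l1norm y) 0.
  by rewrite pos_homogeneous0// normr0 mulr_ge0 ?l1norm_ge0// divr_ge0// ltW.
have {}Ny : 0 < l1norm y by rewrite lt_neqAle eq_sym Ny l1norm_ge0.
pose k := d / 2 / l1norm y.
have k0 : 0 < k by rewrite !divr_gt0.
have /hd : `|0 - k *: y| < d.
  rewrite sub0r normrN (le_lt_trans (mx_norm_le_l1norm _))//.
  by rewrite l1normZ gtr0_norm// /k divfK ?gt_eqF//; lra.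
rewrite pos_homogeneous0// sub0r normrN hh ?(ltW k0)// normrM gtr0_norm//.
rewrite mulrC -ltr_pdivlMr// => /ltW/le_trans; apply.
by rewrite /k mul1r !invfM !invrK (mulrC d^-1).
Qed.

(** Near [x] the increment is at most [eps] by continuity; away from [x] the
    linear growth of [h] is absorbed by a multiple of the distance to [x]. *)
Lemma continuous_l1_upper h x (eps : R) : continuous h -> pos_homogeneous h ->
  0 < eps -> exists2 K : R, 0 <= K &
    forall z, h z <= h x + eps + K * l1norm (z - x).
Proof.
move=> ch hh eps0.
have [M M0 hM] := continuous_l1_bound ch hh.
have [d d0 hd] := continuous_ball x ch eps0.
pose N := l1norm x.
have N0 : 0 <= N by exact: l1norm_ge0.
have K0 : 0 <= 2 * M * N / d by rewrite divr_ge0 ?mulr_ge0// ltW.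
exists (M + 2 * M * N / d) => [|z]; first exact: addr_ge0.
have D0 := l1norm_ge0 (z - x).
have [zd|zd] := ltP (l1norm (z - x)) d.
  have /hd : `|x - z| < d.
    by rewrite distrC (le_lt_trans (mx_norm_le_l1norm _)).
  rewrite ltr_norml => /andP[hz _].
  have : 0 <= (M + 2 * M * N / d) * l1norm (z - x) by rewrite mulr_ge0// addr_ge0.
  lra.
have h1 : h z <= M * l1norm (z - x) + M * N.
  rewrite (le_trans (ler_norm _))// (le_trans (hM _))// -mulrDr ler_wpM2l//.
  by rewrite -{1}(subrK x z) l1normD.
have h2 : - h x <= M * N by rewrite (le_trans (ler_norm _))// normrN.
have h3 : 2 * M * N <= 2 * M * N / d * l1norm (z - x).
  rewrite -[leRHS]mulrA ler_peMr ?mulr_ge0// mulrC ler_pdivlMr//.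
  by rewrite mul1r.
rewrite mulrDl; lra.
Qed.

Lemma continuous_bounded_on_sphere h : continuous h -> pos_homogeneous h ->
  bounded_on_sphere h.
Proof.
move=> ch hh; have [M M0 hM] := continuous_l1_bound ch hh.
exists (M * n%:R) => x x1; rewrite (le_trans (hM x))// ler_wpM2l// /l1norm.
rewrite -[in leRHS](card_ord n) -sumr_const ler_sum// => i _.
have s0 : 0 <= \sum_(j < n) x 0 j ^+ 2 by apply: sumr_ge0 => j _; exact: sqr_ge0.
have s1 : \sum_(j < n) x 0 j ^+ 2 = 1 by rewrite -(sqr_sqrtr s0) x1 expr1n.
rewrite -(@expr_le1 _ 2)// -normrX ger0_norm ?sqr_ge0// -s1.
by rewrite (bigD1 i)//= lerDl sumr_ge0// => j _; exact: sqr_ge0.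
Qed.

Lemma continuous_lsc h : continuous h -> lsc h.
Proof.
move=> ch x a; rewrite lte_fin => ax.
have [d d0 hd] := continuous_ball x ch (ltac:(lra) : 0 < h x - a).
exists (ball x d); first exact: nbhsx_ballx.
by move=> y; rewrite -ball_normE => /hd; rewrite ltr_norml lte_fin => /andP[_]; lra.
Qed.

(** * Sublinear functions are attained on their subdifferentials *)

Section Sublinear.
Variable phi : 'rV[R]_n -> R.
Hypothesis sphi : sublinear phi.

Lemma sublinear0 : phi 0 = 0.
Proof. by case: sphi => /pos_homogeneous0. Qed.

Lemma sublinear_sum (I : Type) (r : seq I) (v : I -> 'rV[R]_n) :
  phi (\sum_(i <- r) v i) <= \sum_(i <- r) phi (v i).
Proof.
elim/big_rec2: _ => [|i s y _ ys]; first by rewrite sublinear0.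
by rewrite (le_trans (sphi.2 _ _))// lerD2l.
Qed.

Lemma sublinear_opp_ge x : - phi (- x) <= phi x.
Proof. by have := sphi.2 x (- x); rewrite subrr sublinear0; lra. Qed.

Lemma sublinear_le_coord y :
  phi y <= \sum_i phi (y 0 i *: delta_mx 0 i).
Proof. by rewrite {1}(row_sum_delta y) sublinear_sum. Qed.

Lemma sublinear_l1_bound : exists2 C : R, 0 <= C & forall y, phi y <= C * l1norm y.
Proof.
pose B i := `|phi (delta_mx 0 i)| + `|phi (- delta_mx 0 i)|.
have B0 i : 0 <= B i by rewrite addr_ge0.
exists (\sum_i B i) => [|y]; first exact: sumr_ge0.
rewrite (le_trans (sublinear_le_coord _))// /l1norm mulr_sumr ler_sum// => i _.
apply: (@le_trans _ _ (B i * `|y 0 i|)); last first.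
  by rewrite ler_wpM2r// (bigD1 i)//= lerDl sumr_ge0.
have [yi|yi] := ger0P (y 0 i).
  rewrite sphi.1// mulrC ler_wpM2r// (le_trans (ler_norm _))//.
  by rewrite lerDl.
rewrite -[y 0 i]opprK scaleNr -scalerN sphi.1 ?oppr_ge0 ?(ltW yi)//.
rewrite opprK mulrC ler_wpM2r ?oppr_ge0 ?(ltW yi)// (le_trans (ler_norm _))//.
by rewrite lerDr.
Qed.

End Sublinear.

(** The witness [y |-> inf_(t >= 0) (phi (y + t e) - t phi e)] is the directional
    derivative of [phi] at [e]; it is linear along the line through [e]. *)
Lemma sublinear_tangent phi e : sublinear phi ->
  exists phi', [/\ sublinear phi', forall y, phi' y <= phi y &
    phi' (- e) = - phi e].
Proof.
move=> sphi; case: (sphi) => hphi aphi.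
pose V y := [set phi (y + t *: e) - t * phi e | t in [set t : R | 0 <= t]].
have lbV y : lbound (V y) (- phi (- y)).
  move=> _ [t /= t0 <-]; have := aphi (y + t *: e) (- y).
  by rewrite addrAC subrr add0r hphi//; lra.
have iV y : has_inf (V y).
  split; first by exists (phi (y + 0 *: e) - 0 * phi e); exists 0 => /=.
  by exists (- phi (- y)).
have infV y t : 0 <= t -> inf (V y) <= phi (y + t *: e) - t * phi e.
  by move=> t0; apply: (ge_inf (iV y).2); exists t.
have inf_glb y r : (forall t, 0 <= t -> r <= phi (y + t *: e) - t * phi e) ->
    r <= inf (V y).
  move=> rV; apply: lb_le_inf; first exact: (iV y).1.
  by move=> _ [t /= t0 <-]; exact: rV.
have phi'_le y : inf (V y) <= phi y.
  by have := infV y 0 (lexx _); rewrite scale0r mul0r addr0 subr0.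
have scale_le (l : R) y : 0 < l -> l * inf (V y) <= inf (V (l *: y)).
  move=> l0; apply: (inf_glb) => t t0.
  have tl : l * (t / l) = t by rewrite mulrC divfK ?gt_eqF.
  have tl0 : 0 <= t / l by rewrite divr_ge0// ltW.
  have := infV y (t / l) tl0.
  rewrite -(ler_pM2l l0) mulrBr -(hphi l (_ + _)) ?(ltW l0)// scalerDr scalerA tl.
  by rewrite (mulrA l (t / l)) tl.
exists (fun y => inf (V y)); split=> //.
- split=> [l y|y z].
    rewrite le_eqVlt => /orP[/eqP<-|l0].
      rewrite scale0r mul0r; apply/eqP; rewrite eq_le; apply/andP; split.
        by rewrite (le_trans (phi'_le _))// sublinear0.
      by apply: (inf_glb) => t t0; rewrite add0r hphi// subrr.
    apply/eqP; rewrite eq_le scale_le// andbT.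
    have li : 0 < l^-1 by rewrite invr_gt0.
    have := scale_le _ (l *: y) li; rewrite scalerA mulVf ?gt_eqF// scale1r.
    by rewrite ler_pdivrMl.
  rewrite -lerBlDr; apply: (inf_glb) => t t0.
  rewrite lerBlDl -lerBlDr; apply: (inf_glb) => s s0.
  have := infV (y + z) (t + s) (addr_ge0 t0 s0).
  have := aphi (y + t *: e) (z + s *: e).
  rewrite addrACA -scalerDl mulrDl; lra.
apply/eqP; rewrite eq_le; apply/andP; split.
  by have := infV (- e) 1 ler01; rewrite scale1r mul1r addNr sublinear0// sub0r.
apply: (inf_glb) => t t0; rewrite lerBrDl -[_ - _]opprB -mulN1r.
have := aphi (- e + t *: e) e.
by rewrite addrAC addNr add0r hphi//; lra.
Qed.

Lemma sublinear_linearize phi (s : seq 'rV[R]_n) : sublinear phi ->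
  exists phi', [/\ sublinear phi', forall y, phi' y <= phi y &
    {in s, forall y, phi' (- y) = - phi' y}].
Proof.
(* A direction along which the larger function is linear leaves no room for
   the smaller one, so linearity survives the later steps. *)
have keep phi0 phi1 y : sublinear phi1 -> (forall y, phi1 y <= phi0 y) ->
    phi0 (- y) = - phi0 y -> phi1 y = phi0 y.
  move=> s1 le10 lin; have := sublinear_opp_ge s1 y.
  have := le10 y; have := le10 (- y); rewrite lin => ? ? ?.
  by apply/eqP; rewrite eq_le; apply/andP; split; lra.
elim: s phi => [|e s IH] phi sphi; first by exists phi; split.
have [phi1 [s1 le1 e1]] := sublinear_tangent e sphi.
have [phi2 [s2 le2 lin2]] := IH _ s1.
have le20 y : phi2 y <= phi y by rewrite (le_trans (le2 _)).
exists phi2; split=> // y.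
rewrite inE => /orP[/eqP->|/lin2//].
have p1e : phi1 e = phi e.
  apply/eqP; rewrite eq_le le1/=.
  by have := sublinear_opp_ge s1 e; rewrite e1 opprK.
have p2e : phi2 e = phi1 e by apply: keep => //; rewrite e1 p1e.
rewrite p2e p1e; apply/eqP; rewrite eq_le.
have := le2 (- e); rewrite e1 => -> /=.
by have := sublinear_opp_ge s2 (- e); rewrite opprK p2e p1e.
Qed.

(** The Hahn-Banach theorem in finite dimension. Taking tangents successively at
    [x] and at the coordinate vectors ends with a linear minorant of [phi]; the
    first tangent prevents the value at [x] from dropping. *)
Theorem subdiff0_attained phi x : sublinear phi ->
  exists2 a, subdiff0 phi a & dotprod a x = phi x.
Proof.
move=> sphi.
have [phi1 [s1 le1 x1]] := sublinear_tangent x sphi.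
have [phi2 [s2 le2 lin2]] :=
  sublinear_linearize [seq delta_mx 0 i | i <- enum 'I_n] s1.
pose a : 'rV[R]_n := \row_i phi2 (delta_mx 0 i).
have coord i (k : R) : phi2 (k *: delta_mx 0 i) = a 0 i * k.
  have lin : phi2 (- delta_mx 0 i) = - phi2 (delta_mx 0 i).
    by apply: lin2; apply: map_f; rewrite mem_enum.
  rewrite mxE; have [k0|k0] := leP 0 k; first by rewrite s2.1// mulrC.
  rewrite -[k]opprK scaleNr -scalerN s2.1 ?oppr_ge0 ?(ltW k0)// lin.
  by rewrite opprK mulrNN mulrC.
have up y : phi2 y <= dotprod a y.
  rewrite (le_trans (sublinear_le_coord s2 _))//.
  by under eq_bigr do rewrite coord.
have dotN y : dotprod a (- y) = - dotprod a y.
  by rewrite /dotprod -sumrN; apply: eq_bigr => i _; rewrite [(- y) 0 i]mxE mulrN.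
have aE y : dotprod a y = phi2 y.
  apply/eqP; rewrite eq_le up andbT.
  by have := sublinear_opp_ge s2 y; have := up (- y); rewrite dotN; lra.
exists a => [y|]; first by rewrite aE (le_trans (le2 _)).
apply/eqP; rewrite aE eq_le (le_trans (le2 _))//=.
have := sublinear_opp_ge s2 x; have := le2 (- x); rewrite x1; lra.
Qed.

(** * Majorants by finite maxima of linear functions *)

(** Polyhedral sublinear functions, as the closure of linear forms under the two
    operations that the majorants below use; both have a counterpart in [E]. *)
Inductive max_linear : ('rV[R]_n -> R) -> Prop :=
| max_linear_dotprod a : max_linear (dotprod a)
| max_linear_max phi psi : max_linear phi -> max_linear psi ->
    max_linear (fun x => Num.max (phi x) (psi x))
| max_linear_add phi psi : max_linear phi -> max_linear psi ->
    max_linear (fun x => phi x + psi x).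

Lemma max_linear_sublinear phi : max_linear phi -> sublinear phi.
Proof.
elim=> [a|f g _ [hf af] _ [hg ag]|f g _ [hf af] _ [hg ag]]; split.
- move=> l x _; rewrite /dotprod mulr_sumr; apply: eq_bigr => i _.
  by rewrite mxE mulrCA.
- move=> x y; rewrite /dotprod -big_split/= ler_sum// => i _.
  by rewrite mxE mulrDr.
- by move=> l x l0; rewrite hf// hg// maxr_pMr.
- move=> x y; rewrite ge_max; apply/andP; split.
    by rewrite (le_trans (af _ _))// lerD// le_max lexx.
  by rewrite (le_trans (ag _ _))// lerD// le_max lexx orbT.
- by move=> l x l0; rewrite hf// hg// mulrDr.
- by move=> x y; rewrite addrACA lerD.
Qed.

Lemma max_linear_sum (I : Type) (r : seq I) (F : I -> 'rV[R]_n -> R) :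
  (forall i, max_linear (F i)) -> max_linear (fun x => \sum_(i <- r) F i x).
Proof.
move=> mF; elim: r => [|i r IH].
  have -> : (fun x => \sum_(i <- [::]) F i x) = dotprod 0.
    by apply/funext => x; rewrite big_nil /dotprod big1// => i _; rewrite mxE mul0r.
  exact: max_linear_dotprod.
have -> : (fun x => \sum_(j <- i :: r) F j x) = (fun x => F i x + \sum_(j <- r) F j x).
  by apply/funext => x; rewrite big_cons.
exact: max_linear_add.
Qed.

(** At [x = 0] a multiple of the l1 norm will do. Otherwise, with [l] a linear
    form such that [l x = 1], the majorant is
    [y |-> max (c l(y)) (- B l(y)) + L |y - l(y) x|_1]. On the half-space where
    [l > 0] homogeneity reduces the claim to the hyperplane [l = 1], where it is
    the Lipschitz-type hypothesis at [x]; on the other half-space the linear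
    growth of [h] is dominated by the term in [B] and by the distance term. *)
Lemma max_linear_majorant h x (c K M : R) : pos_homogeneous h ->
  0 <= K -> 0 <= M -> (forall y, h y <= M * l1norm y) ->
  h x <= c -> (forall z, h z <= c + K * l1norm (z - x)) ->
  exists phi, [/\ max_linear phi, forall y, h y <= phi y & phi x <= c].
Proof.
move=> hh K0 M0 hM hxc hK.
pose L := Num.max K M.
have L0 : 0 <= L by rewrite le_max K0.
have KL : K <= L by rewrite le_max lexx.
have ML : M <= L by rewrite le_max lexx orbT.
pose cone (l : 'rV[R]_n) y := \sum_i Num.max
  (dotprod (L *: (delta_mx 0 i - x 0 i *: l)) y)
  (dotprod (- (L *: (delta_mx 0 i - x 0 i *: l))) y).
have coneE l y : cone l y = L * l1norm (y - dotprod l y *: x).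
  rewrite /cone /l1norm mulr_sumr; apply: eq_bigr => i _.
  rewrite dotprodNl maxrN dotprodZl dotprodDl dotprodNl dotprodZl.
  by rewrite dotprod_delta normrM ger0_norm// !mxE (mulrC (x 0 i)).
have cone_max l : max_linear (cone l).
  by apply: max_linear_sum => i; apply: max_linear_max; exact: max_linear_dotprod.
have [x0|/eqP/rowP x0] := eqVneq x 0.
  exists (cone 0); split=> // [y|].
    by rewrite coneE x0 scaler0 subr0 (le_trans (hM _))// ler_wpM2r// l1norm_ge0.
  rewrite coneE x0 scaler0 subr0 -{1}[0](scale0r 0) l1normZ normr0 mul0r mulr0.
  by rewrite -(pos_homogeneous0 hh) -{1}x0.
have [i xi] : exists i, x 0 i != 0.
  apply: contrapT => nx; apply: x0 => i; rewrite mxE.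
  by apply: contrapT => /eqP xi; apply: nx; exists i.
have [l lx] : exists l, dotprod l x = 1.
  by exists ((x 0 i)^-1 *: delta_mx 0 i); rewrite dotprodZl dotprod_delta mulVf.
(* The summand [`|c|] keeps [- B <= c], so that the value at [x] is [c]. *)
pose B := M * l1norm x + `|c|.
exists (fun y => Num.max (dotprod (c *: l) y) (dotprod (- B *: l) y) + cone l y).
split.
- by apply: max_linear_add => //; apply: max_linear_max; exact: max_linear_dotprod.
- move=> y; rewrite coneE !dotprodZl; set t := dotprod l y.
  have N0 := l1norm_ge0 (y - t *: x).
  have [t0|t0] := ltP 0 t.
    apply: (@le_trans _ _ (c * t + K * l1norm (y - t *: x))); last first.
      by rewrite lerD ?le_max ?lexx// ler_wpM2r.
    have := hK (t^-1 *: y).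
    rewrite -(ler_pM2l t0) -hh ?(ltW t0)// scalerA mulfV ?gt_eqF// scale1r.
    move=> /le_trans; apply; rewrite mulrDr mulrC lerD2l mulrCA.
    rewrite ler_wpM2l// -{1}(gtr0_norm t0) -l1normZ scalerBr scalerA mulfV ?gt_eqF//.
    by rewrite scale1r.
  apply: (@le_trans _ _ (- B * t + M * l1norm (y - t *: x))); last first.
    by rewrite lerD ?le_max ?lexx ?orbT// ler_wpM2r.
  rewrite (le_trans (hM _))//.
  have : l1norm y <= l1norm (y - t *: x) + l1norm (t *: x).
    by rewrite -{1}(subrK (t *: x) y) l1normD.
  move=> /(ler_wpM2l M0)/le_trans; apply.
  rewrite l1normZ ler0_norm// mulrDr addrC lerD2r mulrCA [leLHS]mulrC.
  have -> : - B * t = B * - t by rewrite mulNr mulrN.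
  rewrite ler_wpM2r ?oppr_ge0//.
  by rewrite /B lerDl.
- rewrite coneE !dotprodZl lx scale1r subrr !mulr1.
  rewrite -{1}[0](scale0r 0) l1normZ normr0 mul0r mulr0 addr0 ge_max lexx/=.
  have := ler_norm (- c); rewrite normrN /B.
  have : 0 <= M * l1norm x by rewrite mulr_ge0// l1norm_ge0.
  lra.
Qed.

Lemma continuous_majorant h x (eps : R) : continuous h -> pos_homogeneous h ->
  0 < eps ->
  exists phi, [/\ max_linear phi, forall y, h y <= phi y & phi x <= h x + eps].
Proof.
move=> ch hh e0.
have [M M0 hM] := continuous_l1_bound ch hh.
have [K K0 hK] := continuous_l1_upper x ch hh e0.
apply: (max_linear_majorant hh K0 M0) => // [y|]; last lra.
by rewrite (le_trans (ler_norm _)).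
Qed.

Lemma sublinear_majorant phi x : sublinear phi ->
  exists phi', [/\ max_linear phi', forall y, phi y <= phi' y & phi' x <= phi x].
Proof.
move=> sphi; have [C C0 hC] := sublinear_l1_bound sphi.
apply: (max_linear_majorant sphi.1 C0 C0) => // z.
by rewrite -{1}(subrK x z) addrC (le_trans (sphi.2 _ _))// lerD2l.
Qed.

End HomogeneousTheory.

(** * Separation by homomorphisms on finitely generated sublattices *)

Section Homomorphisms.
Context {R : realType} {E : vectorLatticeType R} {n : nat}.
Implicit Types (f : 'I_n -> E) (g v x y : E) (L : set E) (w : E -> R).
Implicit Types (h phi psi : 'rV[R]_n -> R).

Lemma vlat_hom_on_sub L L' w : L `<=` L' -> vlat_hom_on L' w -> vlat_hom_on L w.
Proof.
move=> LL' [wD wZ wU wI].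
by split=> [x y /LL' + /LL'|a x /LL'|x y /LL' + /LL'|x y /LL' + /LL']; auto.
Qed.

Lemma vlat_hom_on_le L w x y : vlat_hom_on L w -> L x -> L y -> x <= y ->
  w x <= w y.
Proof.
move=> [_ _ wU _] Lx Ly xy; have := wU _ _ Ly Lx.
by rewrite vjoin_idPl// => ->; rewrite le_max lexx orbT.
Qed.

Lemma gen_vector_sublattice_sub (A : set E) : A `<=` gen_vector_sublattice A.
Proof. exact: sub_gen_smallest. Qed.

Lemma gen_vector_sublatticeP (A : set E) :
  vector_sublattice (gen_vector_sublattice A).
Proof.
split.
- by move=> B [[]].
- by move=> x y Ax Ay B AB; have [[_ D _ _] _] := AB; apply: D; [exact: Ax|exact: Ay].
- by move=> a x Ax B AB; have [[_ _ Z _] _] := AB; apply: Z; exact: Ax.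
- move=> x y Ax Ay; split=> B AB; have [[_ _ _ U] _] := AB.
    by have [] := U _ _ (Ax _ AB) (Ay _ AB).
  by have [] := U _ _ (Ax _ AB) (Ay _ AB).
Qed.

Lemma sublattice_lincomb L f a : vector_sublattice L -> (forall i, L (f i)) ->
  L (lincomb f a).
Proof.
move=> [L0 LD LZ _] Lf; rewrite /lincomb.
by elim/big_ind: _ => // i _; exact: LZ.
Qed.

Lemma vlat_hom_on_lincomb L f a w : vector_sublattice L ->
  (forall i, L (f i)) -> vlat_hom_on L w ->
  w (lincomb f a) = dotprod a (\row_i w (f i)).
Proof.
move=> [L0 LD LZ _] Lf [wD wZ _ _].
have w0 : w 0 = 0 by rewrite -(scale0r 0) wZ// mul0r.
suff [] : L (lincomb f a) /\ w (lincomb f a) = dotprod a (\row_i w (f i)) by [].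
rewrite /lincomb /dotprod; elim/big_rec2: _ => // i y x _ [Lx <-].
by split; [apply: LD => //; exact: LZ|rewrite wD ?wZ ?mxE//; exact: LZ].
Qed.

Definition vabs x := vjoin x (- x).

Lemma vabs_bounds x : - vabs x <= x /\ x <= vabs x.
Proof.
by split; [rewrite -vlerN2 opprK vjoin_ubr|exact: vjoin_ubl].
Qed.

Lemma vabs_ge0 x : 0 <= vabs x.
Proof.
have [Nx xN] := vabs_bounds x; have := le_trans Nx xN.
rewrite -vsubr_ge0 opprK -mulr2n -scaler_nat.
by rewrite -[X in X <= _](scaler0 _ 2%:R) vlerZ2lE.
Qed.

Lemma exists_principal_ideal (s : seq E) : exists2 e, 0 <= e &
  {in s, forall x, principal_ideal e x}.
Proof.
have sum_ge0 (r : seq E) : 0 <= \sum_(x <- r) vabs x.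
  by elim/big_ind: _ => // [x y|x _]; [exact: vaddr_ge0|exact: vabs_ge0].
exists (\sum_(x <- s) vabs x) => // x /splitPr[s1 s2].
have le_sum : vabs x <= \sum_(y <- s1 ++ x :: s2) vabs y.
  rewrite big_cat big_cons/= addrCA -[leLHS]addr0 vlerD2//.
  exact: vaddr_ge0.
have [Nx xN] := vabs_bounds x; exists 1; rewrite scale1r.
  by rewrite (le_trans _ Nx)// vlerN2.
exact: le_trans le_sum.
Qed.

(** A homomorphism on the ideal generated by the sum of the absolute values of
    the generators restricts to the sublattice, so that separation on principal
    ideals applies. *)
Theorem vlat_hom_separation (A : set E) (s : seq E) x y :
  archimedean_vlat E -> A `<=` [set` s] ->
  gen_vector_sublattice A x -> gen_vector_sublattice A y ->
  (forall w, vlat_hom_on (gen_vector_sublattice A) w -> w x <= w y) ->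
  x <= y.
Proof.
move=> archE As Ax Ay sep.
have [e e0 es] := exists_principal_ideal s.
have AI : gen_vector_sublattice A `<=` principal_ideal e.
  apply: smallest_sub; first exact: principal_ideal_sublattice.
  by move=> z /As; exact: es.
apply: (principal_ideal_separation archE e0 (AI _ Ax) (AI _ Ay)) => w wI.
by apply: sep; exact: vlat_hom_on_sub wI.
Qed.

(** The element [v] plays the role of [phi (f_1, ..., f_n)]: it is available in
    every sublattice through the [f_i], and homomorphisms see it as [phi]. *)
Definition evaluates phi f v := forall L, vector_sublattice L ->
  (forall i, L (f i)) ->
  L v /\ forall w, vlat_hom_on L w -> w v = phi (\row_i w (f i)).

(** Separation in the form used below: the sublattice is generated by the [f_i]
    and by finitely many further elements [s], and is left abstract so that
    membership of [x] and [y] can be derived from the closure properties. *)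
Lemma vlat_hom_separation_range f (s : seq E) x y :
  archimedean_vlat E ->
  (forall L, vector_sublattice L -> (forall i, L (f i)) -> [set` s] `<=` L ->
     [/\ L x, L y & forall w, vlat_hom_on L w -> w x <= w y]) ->
  x <= y.
Proof.
move=> archE sep; set A := range f `|` [set` s].
have AL := @gen_vector_sublattice_sub A.
have [|z zs|Lx Ly le_xy] := sep _ (gen_vector_sublatticeP A).
- by move=> i; apply: AL; left; exists i.
- by apply: AL; right.
apply: (@vlat_hom_separation A ([seq f i | i <- enum 'I_n] ++ s)) => //.
move=> z [[i _ <-]|zs]; rewrite /= mem_cat; last by rewrite zs orbT.
by rewrite map_f// mem_enum.
Qed.

(** * Comparison of the two calculi *)

(** The lattice expression of [phi] in linear forms, computed in [E] instead of
    the reals, is the value: it is an upper bound of the linear combinations by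
    separation, and induction on the expression shows that it is the least. *)
Lemma max_linear_value phi f : archimedean_vlat E -> max_linear phi ->
  exists2 v, evaluates phi f v & sublinear_value phi f v.
Proof.
move=> archE mphi.
suff [v ev lub] : exists2 v, evaluates phi f v &
    forall u, (forall a, subdiff0 phi a -> lincomb f a <= u) -> v <= u.
  exists v => //; split=> [_ [a aphi <-]|u uub]; last first.
    by apply: lub => a aphi; apply: uub; exists a.
  apply: (@vlat_hom_separation_range f [::]) => // L sL Lf _.
  have [Lv wv] := ev L sL Lf; split=> //; first exact: sublattice_lincomb.
  by move=> w wL; rewrite wv// (vlat_hom_on_lincomb _ sL).
elim: mphi => [a|phi1 phi2 _ [v1 ev1 lub1] _ [v2 ev2 lub2]
  |phi1 phi2 _ [v1 ev1 lub1] _ [v2 ev2 lub2]].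
- exists (lincomb f a) => [L sL Lf|u]; last by apply=> x.
  split; first exact: sublattice_lincomb.
  by move=> w wL; rewrite (vlat_hom_on_lincomb _ sL).
- exists (vjoin v1 v2) => [L sL Lf|u uub].
    have [L1 w1] := ev1 L sL Lf; have [L2 w2] := ev2 L sL Lf.
    split; first by case: sL => _ _ _ /(_ _ _ L1 L2)[].
    by move=> w wL; case: (wL) => _ _ wU _; rewrite wU// w1// w2.
  apply: vjoin_lub; [apply: lub1 => a a1|apply: lub2 => a a2]; apply: uub => x.
    by rewrite le_max a1.
  by rewrite le_max a2 orbT.
- exists (v1 + v2) => [L sL Lf|u uub].
    have [L1 w1] := ev1 L sL Lf; have [L2 w2] := ev2 L sL Lf.
    split; first by case: sL => _ + _ _; apply.
    by move=> w wL; case: (wL) => wD _ _ _; rewrite wD// w1// w2.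
  have lincombD a b : lincomb f (a + b) = lincomb f a + lincomb f b.
    by rewrite /lincomb -big_split; apply: eq_bigr => i _; rewrite mxE scalerDl.
  rewrite addrC -vlerBrDr; apply: lub2 => b b2.
  rewrite vlerBrDr addrC -vlerBrDr; apply: lub1 => a a1.
  rewrite vlerBrDr -lincombD; apply: uub => x.
  by rewrite dotprodDl lerD ?a1 ?b2.
Qed.

(** All polyhedral majorants of [h] form a suitable family. In both halves of
    the claim that [g] is the infimum, separation reduces inequalities in [E] to
    inequalities between reals at a point [(w f_1, ..., w f_n)]. *)
Lemma c_calculus_s_calculus_usc h f g : archimedean_vlat E ->
  continuous h -> pos_homogeneous h ->
  c_calculus h f g -> s_calculus_usc h f g.
Proof.
move=> archE ch hh cg.
exists [set phi | max_linear phi /\ forall z, h z <= phi z].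
have cg_le L w : vector_sublattice L -> (forall i, L (f i)) -> L g ->
    vlat_hom_on L w -> h (\row_i w (f i)) = w g.
  move=> sL Lf Lg wL; apply: cg; apply: vlat_hom_on_sub wL.
  by apply: smallest_sub => // _ [[i _ <-]|->].
split.
- by move=> phi [/max_linear_sublinear].
- move=> x; split=> [_ [phi [_ hphi] <-]|r rlb]; first exact: hphi.
  apply/ler_addgt0Pr => eps eps0.
  have [phi [mphi hphi phix]] := continuous_majorant x ch hh eps0.
  by apply: le_trans phix; apply: rlb; exists phi.
- by move=> phi [mphi _]; have [v _] := max_linear_value f archE mphi; exists v.
split=> [v [phi [mphi hphi] vphi]|u ulb].
  have [v' ev v'phi] := max_linear_value f archE mphi.
  apply: le_trans (v'phi.2 _ vphi.1).
  apply: (@vlat_hom_separation_range f [:: g]) => // L sL Lf Lg.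
  have [Lv wv] := ev L sL Lf; have {}Lg : L g by apply: Lg; rewrite /= inE.
  by split=> // w wL; rewrite wv// -(cg_le L).
apply: (@vlat_hom_separation_range f [:: g; u]) => // L sL Lf Lgu.
have Lg : L g by apply: Lgu; rewrite /= inE eqxx.
have Lu : L u by apply: Lgu; rewrite /= !inE eqxx orbT.
split=> // w wL; rewrite -(cg_le L)//; apply/ler_addgt0Pr => eps eps0.
have [phi [mphi hphi phix]] := continuous_majorant (\row_i w (f i)) ch hh eps0.
have [v ev vphi] := max_linear_value f archE mphi.
have [Lv wv] := ev L sL Lf.
apply: le_trans phix; rewrite -wv//; apply: (vlat_hom_on_le wL) => //.
by apply: ulb; exists phi.
Qed.

(** A homomorphism [w] on the sublattice generated by the [f_i] and [g] need not
    preserve infinite bounds nor be defined at the values of the family [Phi].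
    Both inequalities therefore pass through polyhedral functions, whose values
    lie in that sublattice: majorants of the members of [Phi] bound [w g] from
    above, minorants of [h] bound it from below. *)
Lemma s_calculus_usc_c_calculus h f g : archimedean_vlat E ->
  continuous h -> pos_homogeneous h ->
  s_calculus_usc h f g -> c_calculus h f g.
Proof.
move=> archE ch hh [Phi [Phis hinf Phiv [glb ggt]]] w.
set L := gen_vector_sublattice _ => wL.
have sL : vector_sublattice L by exact: gen_vector_sublatticeP.
have Lf i : L (f i) by apply: gen_vector_sublattice_sub; left; exists i.
have Lg : L g by apply: gen_vector_sublattice_sub; right.
set x := \row_i w (f i).
have [hlb hgt] := hinf x.
apply/eqP; rewrite eq_le; apply/andP; split; last first.
  apply: hgt => _ [phi Pphi <-].
  have [phi' [mphi' le_phi phi'x]] := sublinear_majorant x (Phis _ Pphi).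
  have [v vphi] := Phiv _ Pphi.
  have [v' ev [v'ub _]] := max_linear_value f archE mphi'.
  have [Lv' wv'] := ev L sL Lf.
  apply: le_trans phi'x; rewrite -wv'//; apply: (vlat_hom_on_le wL) => //.
  apply: (@le_trans _ _ v); first by apply: glb; exists phi.
  apply: vphi.2 => _ [a aphi <-]; apply: v'ub; exists a => // y.
  by rewrite (le_trans (aphi y)).
apply/ler_addgt0Pr => eps eps0.
have chN : continuous (fun z => - h z).
  by move=> z; exact: (cvgN (ch z)).
have hhN : pos_homogeneous (fun z => - h z).
  by move=> l z l0; rewrite hh// mulrN.
(* [- psi] is a minorant of [h] within [eps] at [x], and [- u] its value. *)
have [psi [mpsi hpsi psix]] := continuous_majorant x chN hhN eps0.
have [u eu _] := max_linear_value f archE mpsi.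
have [Lu wu] := eu L sL Lf.
suff : - u <= g.
  move=> ug; have LNu : L (- u).
    by case: sL => _ _ LZ _; rewrite -scaleN1r; exact: LZ.
  have := vlat_hom_on_le wL LNu Lg ug; case: (wL) => _ wZ _ _.
  rewrite -scaleN1r wZ// wu//; rewrite -/x; lra.
apply: ggt => v [phi Pphi vphi].
apply: (@vlat_hom_separation_range f [:: v]) => // L' sL' Lf' Lv.
have {}Lv : L' v by apply: Lv; rewrite /= inE.
have [Lu' wu'] := eu L' sL' Lf'; split=> //.
  by case: sL' => _ _ LZ _; rewrite -scaleN1r; exact: LZ.
move=> w' wL'; set x' := \row_i w' (f i).
have -> : w' (- u) = - psi x'.
  by case: (wL') => _ wZ _ _; rewrite -scaleN1r wZ// mulN1r wu'.
(* Only the linear minorants of [phi] are known to be below [v] in [E]; one of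
   them reaches [phi] at [x']. *)
have [a aphi ax] := subdiff0_attained x' (Phis _ Pphi).
apply: (@le_trans _ _ (phi x')).
  have [+ _] := hinf x'; move=> /(_ (phi x')) hphi.
  have : h x' <= phi x' by apply: hphi; exists phi.
  by have := hpsi x'; lra.
rewrite -ax -(vlat_hom_on_lincomb _ sL' Lf' wL').
apply: (vlat_hom_on_le wL') => //; first exact: sublattice_lincomb.
by case: vphi => + _; apply; exists a.
Qed.

End Homomorphisms.

(** * Lower semicontinuous representations, by change of sign *)

Section Duality.
Context {disp : Order.disp_t} {T : porderType disp} (N : T -> T).
Hypotheses (NK : involutive N) (le_N : forall x y, (N x <= N y)%O = (y <= x)%O).

Lemma infimums_antitone (A : set T) x :
  infimums (N @` A) (N x) <-> supremums A x.
Proof.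
have le_NC a b : (N a <= b)%O = (N b <= a)%O by rewrite -[b in LHS]NK le_N.
have le_CN a b : (a <= N b)%O = (b <= N a)%O by rewrite -[a in LHS]NK le_N.
split=> -[ub lub]; split.
- by move=> a Aa; rewrite -le_N; apply: ub; exists a.
- move=> b bub; rewrite -le_N; apply: lub => _ [a Aa <-].
  by rewrite le_N bub.
- by move=> _ [a Aa <-]; rewrite le_N ub.
- move=> b blb; rewrite le_CN; apply: lub => a Aa.
  by rewrite le_CN blb//; exists a.
Qed.

Lemma supremums_antitone (A : set T) x :
  supremums (N @` A) (N x) <-> infimums A x.
Proof.
rewrite -infimums_antitone NK image_comp.
suff -> : N \o N = id by rewrite image_id.
by apply/funext => a /=; rewrite NK.
Qed.

End Duality.

Section ChangeOfSign.
Context {R : realType} {E : vectorLatticeType R} {n : nat}.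
Implicit Types (f : 'I_n -> E) (g v : E) (h psi : 'rV[R]_n -> R).

Let oppE_antitone (x y : E) : (- x <= - y) = (y <= x).
Proof. exact: vlerN2. Qed.

Let oppR_antitone (x y : R) : (- x <= - y) = (y <= x).
Proof. exact: lerN2. Qed.

Lemma superlinear_value_opp psi f v :
  sublinear_value (fun x => - psi x) f (- v) <-> superlinear_value psi f v.
Proof.
rewrite /superlinear_value -(supremums_antitone opprK oppE_antitone).
rewrite /sublinear_value; set A := [set _ | _ in _]; set B := _ @` _.
suff -> : A = B by [].
have lincombN a : lincomb f (- a) = - lincomb f a.
  by rewrite /lincomb -sumrN; apply: eq_bigr => i _; rewrite mxE scaleNr.
apply/seteqP; split=> [_ [a apsi <-]|_ [_ [a apsi <-] <-]].
  exists (lincomb f (- a)); last by rewrite lincombN opprK.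
  by exists (- a) => // x; rewrite dotprodNl lerNr; exact: apsi.
by exists (- a) => // x; rewrite dotprodNl lerN2; exact: apsi.
Qed.

Lemma s_calculus_lsc_opp h f g :
  s_calculus_lsc h f g -> s_calculus_usc (fun x => - h x) f (- g).
Proof.
move=> [Psi [Psis hsup Psiv gsup]].
exists [set (fun x => - psi x) | psi in Psi]; split.
- by move=> _ [psi /Psis ? <-].
- move=> x; have := (infimums_antitone opprK oppR_antitone _ _).2 (hsup x).
  by rewrite !image_comp.
- move=> _ [psi /Psiv[v vpsi] <-]; exists (- v); exact/superlinear_value_opp.
have := (infimums_antitone opprK oppE_antitone _ _).2 gsup.
set A := _ @` _; set B := [set _ | _]; suff -> : A = B by [].
apply/seteqP; split=> [_ [v [psi Ppsi vpsi] <-]|v [_ [psi Ppsi <-] vpsi]].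
  exists (fun x => - psi x); first by exists psi.
  exact/superlinear_value_opp.
exists (- v); last by rewrite opprK.
by exists psi => //; apply/superlinear_value_opp; rewrite opprK.
Qed.

Lemma c_calculus_opp h f g :
  c_calculus (fun x => - h x) f (- g) -> c_calculus h f g.
Proof.
move=> cg w wL.
have [_ _ LZ _] := gen_vector_sublatticeP (range f `|` [set g]).
have Lg : gen_vector_sublattice (range f `|` [set g]) g.
  by apply: gen_vector_sublattice_sub; right.
have /cg : vlat_hom_on (gen_vector_sublattice (range f `|` [set - g])) w.
  apply: vlat_hom_on_sub wL; apply: smallest_sub.
    exact: gen_vector_sublatticeP.
  move=> _ [[i _ <-]|->]; last by rewrite -scaleN1r; exact: LZ.
  by apply: gen_vector_sublattice_sub; left; exists i.
by case: wL => _ wZ _ _; rewrite -[- g]scaleN1r wZ// mulN1r => /oppr_inj.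
Qed.

Lemma s_calculus_c_calculus h f g : archimedean_vlat E ->
  continuous h -> pos_homogeneous h -> s_calculus h f g -> c_calculus h f g.
Proof.
move=> archE ch hh [_ _ [[_]|[_ /s_calculus_lsc_opp sg]]].
  exact: s_calculus_usc_c_calculus.
apply/c_calculus_opp/s_calculus_usc_c_calculus => //.
  by move=> y; exact: (cvgN (ch y)).
by move=> l y l0; rewrite hh// mulrN.
Qed.

Lemma c_calculus_s_calculus h f g : archimedean_vlat E ->
  continuous h -> pos_homogeneous h -> c_calculus h f g -> s_calculus h f g.
Proof.
move=> archE ch hh cg; split=> //; first exact: continuous_bounded_on_sphere.
left; split; last exact: c_calculus_s_calculus_usc.
by apply: continuous_lsc => y; exact: (cvgN (ch y)).
Qed.

Lemma c_calculus_unique h f g g' : archimedean_vlat E ->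
  c_calculus h f g -> c_calculus h f g' -> g = g'.
Proof.
move=> archE.
have le_value u u' : c_calculus h f u -> c_calculus h f u' -> u <= u'.
  move=> cu cu'; apply: (@vlat_hom_separation_range _ _ _ f [:: u; u']) => //.
  move=> L sL Lf Ls.
  have Lu : L u by apply: Ls; rewrite /= inE eqxx.
  have Lu' : L u' by apply: Ls; rewrite /= !inE eqxx orbT.
  split=> // w wL; rewrite -cu -?cu'//; apply: vlat_hom_on_sub wL;
    by apply: smallest_sub => // _ [[i _ <-]|->].
by move=> cg cg'; apply/le_anti; rewrite !le_value.
Qed.

End ChangeOfSign.

Theorem corollary7p3 (R : realType) (n : nat) (E : vectorLatticeType R)
    (h : 'rV[R]_n -> R) (f : 'I_n -> E) :
  archimedean_vlat E -> continuous h -> pos_homogeneous h ->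
  ((exists g : E, c_calculus h f g) <-> (exists g : E, s_calculus h f g)) /\
  (forall g g' : E, c_calculus h f g -> s_calculus h f g' -> g = g').
Proof.
move=> archE ch hh; split; first split=> -[g].
- by move=> cg; exists g; exact: c_calculus_s_calculus.
- by move=> sg; exists g; exact: s_calculus_c_calculus.
move=> g g' cg /(s_calculus_c_calculus archE ch hh).
exact: c_calculus_unique.
Qed.
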